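(* Let $R$ be a maximal subring of a ring $T$. Then the following hold: (1) $\mathrm{rad}_R((R:T))=(R:T)_l\cap (R:T)_r$. (2) $(R:T)$ is a prime ideal of $R$ if and only if either $(R:T)=(R:T)_l$ or $(R:T)=(R:T)_r$, if and only if $(R:T)_l$ and $(R:T)_r$ are comparable under inclusion. (3) $|\mathrm{Min}_R((R:T))|\leq 2$. In fact, $|\mathrm{Min}_R((R:T))|=1$ if and only if $(R:T)_l$ and $(R:T)_r$ are comparable. Otherwise $\mathrm{Min}_R((R:T))=\{(R:T)_l,(R:T)_r\}$ and either $(R:T)$ is a prime ideal of $T$ or there exist $Q_l$ and $Q_r$ in $\mathrm{Min}_T((R:T))$ such that $Q_l\cap R=(R:T)_l$, $Q_r\cap R=(R:T)_r$, and, as rings, $R/(R:T)_l\cong T/Q_l$ and $R/(R:T)_r\cong T/Q_r$. (4) $(R:T)$ is a semiprime ideal of $R$ if and only if $(R:T)=(R:T)_l\cap (R:T)_r$. (5) If $R$ is a zero-dimensional ring, then $(R:T)_l$ and $(R:T)_r$ are maximal ideals of $R$. Hence either $(R:T)=(R:T)_l=(R:T)_r$ or $(R:T)_l+(R:T)_r=R$. (6) $(R:T)=\mathrm{r.ann}_T(T/(R:T)_r)=\mathrm{l.ann}_T(T/(R:T)_l)=\mathrm{l.ann}_R(T/(R:T)_l)=\mathrm{r.ann}_R(T/(R:T)_r)$. In particular, if $(R:T)_l$ is a maximal left ideal of $T$ (resp. $(R:T)_r$ is a maximal right ideal of $T$), then $(R:T)$ is a left (resp. right) primitive ideal of $T$.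 (7) If $(R:T)$ is a maximal ideal of $R$, then $(R:T)=(R:T)_l=(R:T)_r$. (8) If the Jacobson radical $J(R)$ is nilpotent (in particular, if $R$ is a one-sided Artinian ring), then $J(R)\subseteq (R:T)_l\cap (R:T)_r$ and $J(R)^2\subseteq (R:T)$. (9) If $\mathrm{Nil}^*(R)$ is nilpotent (in particular, if $R$ is a one-sided Noetherian ring), then $\mathrm{Nil}^*(R)\subseteq (R:T)_l\cap (R:T)_r$ and $(\mathrm{Nil}^*(R))^2\subseteq (R:T)$.
   Context: All rings are associative, unital with $1\neq 0$, and not necessarily commutative; subrings contain the identity of the overring; modules are unital. A subring $R\subsetneq T$ is a maximal subring of $T$ if there is no subring $S$ with $R\subsetneq S\subsetneq T$. For a subring $R\subseteq T$: $(R:T):=\{x\in T\mid TxT\subseteq R\}$, $(R:T)_l:=\{x\in T\mid Tx\subseteq R\}$ and $(R:T)_r:=\{x\in T\mid xT\subseteq R\}$ are respectively the largest two-sided ideal, left ideal and right ideal of $T$ contained in $R$; $(R:T)_l$ and $(R:T)_r$ are two-sided ideals of $R$. For an ideal $I$ of a ring $S$, $\mathrm{Min}_S(I)$ is the set of prime ideals of $S$ minimal over $I$, and $\mathrm{rad}_S(I)$ is the prime radical of $I$ (the intersection of all prime ideals of $S$ containing $I$). For a left (resp. right) $S$-module $M$, $\mathrm{l.ann}_S(M)$ (resp. $\mathrm{r.ann}_S(M)$) is its annihilator in $S$; e.g. $\mathrm{l.ann}_S(T/(R:T)_l)=\{x\in S\mid xT\subseteq (R:T)_l\}$ and $\mathrm{r.ann}_S(T/(R:T)_r)=\{x\in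 S\mid Tx\subseteq (R:T)_r\}$ for $S=R$ or $S=T$. A ring is zero-dimensional if each of its prime ideals is a maximal ideal. A left (resp. right) primitive ideal is the annihilator of a simple left (resp. right) module. $\mathrm{Nil}^*(R)$ is the upper nilradical of $R$ (the largest nil two-sided ideal). *)

(* Defs.v *)
From HB Require Import structures.
From mathcomp Require Import all_boot all_order all_algebra.
From mathcomp Require Import generic_quotient ring_quotient.
From mathcomp Require Import boolp classical_sets functions cardinality.

Set Implicit Arguments.
Unset Strict Implicit.
Unset Printing Implicit Defensive.

Import GRing.Theory.
Local Open Scope classical_set_scope.
Local Open Scope ring_scope.

Section Ideals.
Variable S : pzRingType.
Implicit Types (I J P : set S) (C : set (set S)).

Definition left_ideal I : Prop :=
  [/\ I 0, forall x y, I x -> I y -> I (x - y) & forall a x, I x -> I (a * x)].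

Definition right_ideal I : Prop :=
  [/\ I 0, forall x y, I x -> I y -> I (x - y) & forall a x, I x -> I (x * a)].

Definition ideal I : Prop := left_ideal I /\ right_ideal I.

Definition maximal_proper C I : Prop :=
  [/\ C I, I <> setT & forall J, C J -> I `<=` J -> J = I \/ J = setT].

Definition maximal_ideal I : Prop := maximal_proper ideal I.
Definition maximal_left_ideal I : Prop := maximal_proper left_ideal I.
Definition maximal_right_ideal I : Prop := maximal_proper right_ideal I.

Definition ideal_sum I J : set S := [set x + y | x in I & y in J].

Definition ideal_prod I J : set S :=
  [set x | exists n (a b : 'I_n -> S),
     [/\ forall i, I (a i), forall i, J (b i) & x = \sum_(i < n) a i * b i]].

(* The exponent 1 gives I itself, and the exponent 0 the whole ring. *)
Definition ideal_pow I n : set S := iterop n ideal_prod I setT.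

Definition nilpotent_ideal I : Prop := exists n, ideal_pow I n = [set 0].

Definition prime_ideal P : Prop :=
  [/\ ideal P, P <> setT &
      forall I J, ideal I -> ideal J -> ideal_prod I J `<=` P ->
        I `<=` P \/ J `<=` P].

Definition semiprime_ideal P : Prop :=
  ideal P /\ forall I, ideal I -> ideal_pow I 2 `<=` P -> I `<=` P.

Definition min_primes I : set (set S) :=
  [set P | [/\ prime_ideal P, I `<=` P &
     forall Q, prime_ideal Q -> I `<=` Q -> Q `<=` P -> Q = P]].

Definition prime_radical I : set S :=
  \bigcap_(P in [set P | prime_ideal P /\ I `<=` P]) P.

Definition jacobson : set S := \bigcap_(M in maximal_left_ideal) M.

Definition nil_ideal I : Prop :=
  ideal I /\ forall x, I x -> exists n, x ^+ n = 0.

(* The sum of two nil ideals is nil, so this union of all nil ideals is the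
   largest one: see upper_nilradicalP. *)
Definition upper_nilradical : set S := \bigcup_(I in nil_ideal) I.

Definition stationary (I : nat -> set S) : Prop :=
  exists n, forall m, (n <= m)%N -> I m = I n.

Definition artinian_for C : Prop :=
  forall I : nat -> set S, (forall n, C (I n)) ->
    (forall n, I n.+1 `<=` I n) -> stationary I.

Definition noetherian_for C : Prop :=
  forall I : nat -> set S, (forall n, C (I n)) ->
    (forall n, I n `<=` I n.+1) -> stationary I.

Definition left_artinian : Prop := artinian_for left_ideal.
Definition right_artinian : Prop := artinian_for right_ideal.
Definition left_noetherian : Prop := noetherian_for left_ideal.
Definition right_noetherian : Prop := noetherian_for right_ideal.

Definition zero_dimensional : Prop :=
  forall P, prime_ideal P -> maximal_ideal P.

Definition simple_module (M : lmodType S) : Prop :=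
  (exists m : M, m != 0) /\
  forall N : set M, N 0 -> (forall x y, N x -> N y -> N (x + y)) ->
    (forall a x, N x -> N (a *: x)) -> N = [set 0] \/ N = setT.

Definition module_ann (M : lmodType S) : set S :=
  [set a | forall m : M, a *: m = 0].

Definition left_primitive_ideal I : Prop :=
  exists2 M : lmodType S, simple_module M & I = module_ann M.

End Ideals.

Arguments jacobson : clear implicits.
Arguments upper_nilradical : clear implicits.
Arguments left_artinian : clear implicits.
Arguments right_artinian : clear implicits.
Arguments left_noetherian : clear implicits.
Arguments right_noetherian : clear implicits.
Arguments zero_dimensional : clear implicits.

(* A right S-module is a left module over the converse ring S^c. *)
Definition right_primitive_ideal (S : pzRingType) (I : set S) : Prop :=
  @left_primitive_ideal S^c I.

Section UpperNilradical.
Variable S : pzRingType.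

Lemma nil_ideal_sum (I J : set S) :
  nil_ideal I -> nil_ideal J -> nil_ideal (ideal_sum I J).
Proof.
move=> [[[I0 IB Il] [_ _ Ir]] In] [[[J0 JB Jl] [_ _ Jr]] Jn].
have sum0 : ideal_sum I J 0 by exists 0 => //; exists 0; rewrite ?addr0.
have sumB x y : ideal_sum I J x -> ideal_sum I J y -> ideal_sum I J (x - y).
  move=> [a Ia [b Jb <-]] [c Ic [d Jd <-]].
  by exists (a - c); [exact: IB|exists (b - d);
    [exact: JB|rewrite opprD addrACA]].
split; first split.
- split=> // r _ [a Ia [b Jb <-]].
  by exists (r * a); [exact: Il|exists (r * b); [exact: Jl|rewrite mulrDr]].
- split=> // r _ [a Ia [b Jb <-]].
  by exists (a * r); [exact: Ir|exists (b * r); [exact: Jr|rewrite mulrDl]].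
- move=> _ [a Ia [b Jb <-]].
  have [n an0] := In a Ia.
  have JX k : J ((a + b) ^+ k - a ^+ k).
    elim: k => [|k IHk]; first by rewrite !expr0 subrr.
    have -> : (a + b) ^+ k.+1 - a ^+ k.+1 =
        (a + b) * ((a + b) ^+ k - a ^+ k) - - (b * a ^+ k).
      by rewrite opprK !exprS mulrBr [X in _ = _ - X + _]mulrDl opprD addrA
         subrK.
    have JbA : J (0 - b * a ^+ k) by apply/(JB _ _ J0)/Jr.
    by apply: (JB); [exact: Jl|rewrite -sub0r].
  have [m xm0] := Jn _ (JX n).
  by exists (n * m)%N; rewrite exprM -[X in X ^+ m]subr0 -[X in _ - X]an0.
Qed.

Lemma upper_nilradicalP :
  nil_ideal (upper_nilradical S) /\
  forall I : set S, nil_ideal I -> I `<=` upper_nilradical S.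
Proof.
have nil0 : nil_ideal ([set 0] : set S).
  split; last by move=> x ->; exists 1%N; rewrite expr1.
  by split; split=> // [x y -> ->|a x ->]; rewrite ?subrr ?mulr0 ?mul0r.
split; last by move=> I nI x Ix; exists I.
have N0 : upper_nilradical S 0 by exists [set 0].
have NB x y : upper_nilradical S x -> upper_nilradical S y ->
    upper_nilradical S (x - y).
  move=> [I nI Ix] [J nJ Jy]; exists (ideal_sum I J).
    exact: nil_ideal_sum.
  have [[[J0 JB _] _] _] := nJ.
  by exists x => //; exists (- y) => //; rewrite -sub0r; exact: JB.
split; last by move=> x [I [_ nI] /nI].
split; split=> // a x [I nI Ix]; exists I => //.
- by have [[[_ _ +] _] _] := nI; apply.
- by have [[_ [_ _ +]] _] := nI; apply.
Qed.

End UpperNilradical.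

(* ring_quotient only equips quotients of commutative rings with a product;
   here the product is added for two-sided ideals of arbitrary rings. *)
Record two_sided_ideal (S : pzRingType) := TwoSidedIdeal {
  ideal_set :> set S;
  ideal_setP : ideal ideal_set
}.

Section QuotientRing.
Variables (S : pzRingType) (I : two_sided_ideal S).

Definition ideal_pred : {pred S} := fun x => x \in ideal_set I.

Lemma ideal_pred_zmod : zmod_closed ideal_pred.
Proof.
have [[I0 IB _] _] := ideal_setP I.
split; first exact: mem_set.
by move=> x y /set_mem Ix /set_mem Iy; apply: mem_set; exact: IB.
Qed.

HB.instance Definition _ :=
  GRing.isZmodClosed.Build S ideal_pred ideal_pred_zmod.

Definition quot_ring : Type := {ideal_quot ideal_pred}.

HB.instance Definition _ := GRing.Zmodule.on quot_ring.
HB.instance Definition _ := EqQuotient.on quot_ring.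

Local Open Scope quotient_scope.

Definition quot_pi (x : S) : quot_ring := \pi_({ideal_quot ideal_pred}) x.
Definition quot_mul (x y : quot_ring) : quot_ring := quot_pi (repr x * repr y).

Lemma quot_piE x y : quot_pi x = quot_pi y <-> ideal_set I (x - y).
Proof.
have -> : ideal_set I (x - y) <-> x - y \in ideal_pred
  by split=> [Ixy|Ixy]; [exact: mem_set|exact: set_mem].
by rewrite Quotient.idealrBE; split=> /eqP.
Qed.

Lemma quot_piK (x : quot_ring) : quot_pi (repr x) = x.
Proof. exact: (@reprK _ {ideal_quot ideal_pred}). Qed.

Lemma quot_piM x y : quot_mul (quot_pi x) (quot_pi y) = quot_pi (x * y).
Proof.
have [[_ IB Il] [_ _ Ir]] := ideal_setP I.
apply/quot_piE; set x' := repr _; set y' := repr _.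
have Ix : ideal_set I (x' - x) by apply/quot_piE; exact: quot_piK.
have Iy : ideal_set I (y - y').
  by apply/quot_piE; rewrite -[LHS]quot_piK.
have -> : x' * y' - x * y = (x' - x) * y' - x * (y - y').
  by rewrite mulrBl mulrBr opprB addrA subrK.
by apply: IB; [exact: Ir|exact: Il].
Qed.

Lemma quot_piD x y : quot_pi x + quot_pi y = quot_pi (x + y).
Proof. by rewrite [RHS](raddfD (\pi_({ideal_quot ideal_pred}))). Qed.

Lemma quot_mulA : associative quot_mul.
Proof.
by move=> x y z; rewrite -[x]quot_piK -[y]quot_piK -[z]quot_piK !quot_piM mulrA.
Qed.

Lemma quot_mul1l : left_id (quot_pi 1) quot_mul.
Proof. by move=> x; rewrite -[x]quot_piK quot_piM mul1r. Qed.

Lemma quot_mul1r : right_id (quot_pi 1) quot_mul.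
Proof. by move=> x; rewrite -[x]quot_piK quot_piM mulr1. Qed.

Lemma quot_mulDl : left_distributive quot_mul +%R.
Proof.
move=> x y z; rewrite -[x]quot_piK -[y]quot_piK -[z]quot_piK.
by rewrite quot_piD !quot_piM quot_piD mulrDl.
Qed.

Lemma quot_mulDr : right_distributive quot_mul +%R.
Proof.
move=> x y z; rewrite -[x]quot_piK -[y]quot_piK -[z]quot_piK.
by rewrite quot_piD !quot_piM quot_piD mulrDr.
Qed.

HB.instance Definition _ := GRing.Zmodule_isPzRing.Build quot_ring
  quot_mulA quot_mul1l quot_mul1r quot_mulDl quot_mulDr.

End QuotientRing.

Definition ring_isomorphic (A B : pzRingType) : Prop :=
  exists f : {rmorphism A -> B}, bijective f.

Section SubringType.
Variables (T : nzRingType) (R : subringClosed T).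

Record subring : Type := Subring { subring_val : T; _ : subring_val \in R }.

HB.instance Definition _ := [isSub for subring_val].
HB.instance Definition _ := [Choice of subring by <:].
HB.instance Definition _ := [SubChoice_isSubNzRing of subring by <:].

End SubringType.

Section MaximalSubring.
Variables (T : nzRingType) (R : subringClosed T).

Definition maximal_subring : Prop :=
  [set` R] `<` setT /\
  ~ exists S : subringClosed T, [set` R] `<` [set` S] /\ [set` S] `<` setT.

Definition colon : set T := [set x | forall a b, a * x * b \in R].
Definition colon_l : set T := [set x | forall a, a * x \in R].
Definition colon_r : set T := [set x | forall a, x * a \in R].

Definition inter_subring (I : set T) : set (subring R) := [set x | I (val x)].

(* For a left ideal L of T, the annihilator in S of the left module T / L *)
Definition quot_lann (S L : set T) : set T :=
  [set x | S x /\ forall t, L (x * t)].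

(* For a right ideal L of T, the annihilator in S of the right module T / L *)
Definition quot_rann (S L : set T) : set T :=
  [set x | S x /\ forall t, L (t * x)].

Lemma colon_l_idealP : ideal (inter_subring colon_l).
Proof.
have c0 : inter_subring colon_l 0 by move=> a; rewrite /= mulr0 rpred0.
have cB x y : inter_subring colon_l x -> inter_subring colon_l y ->
    inter_subring colon_l (x - y).
  by move=> cx cy a; rewrite /= mulrBr rpredB ?cx ?cy.
split; split=> // a x cx t; rewrite /= mulrA.
  exact: cx.
by apply: rpredM; [exact: cx|exact: valP].
Qed.

Lemma colon_r_idealP : ideal (inter_subring colon_r).
Proof.
have c0 : inter_subring colon_r 0 by move=> a; rewrite /= mul0r rpred0.
have cB x y : inter_subring colon_r x -> inter_subring colon_r y ->
    inter_subring colon_r (x - y).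
  by move=> cx cy a; rewrite /= mulrBl rpredB ?cx ?cy.
split; split=> // a x cx t; rewrite /= -mulrA.
  by apply: rpredM; [exact: valP|exact: cx].
exact: cx.
Qed.

Definition colon_l_ideal : two_sided_ideal (subring R) :=
  TwoSidedIdeal colon_l_idealP.
Definition colon_r_ideal : two_sided_ideal (subring R) :=
  TwoSidedIdeal colon_r_idealP.

End MaximalSubring.

Arguments inter_subring {T} R I.

(* Main.v *)
Require Import Defs.
From HB Require Import structures.
From mathcomp Require Import all_boot all_order all_algebra.
From mathcomp Require Import generic_quotient ring_quotient.
From mathcomp Require Import boolp classical_sets functions cardinality.

Set Implicit Arguments.
Unset Strict Implicit.
Unset Printing Implicit Defensive.

Import GRing.Theory.

Local Open Scope classical_set_scope.
Local Open Scope card_scope.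
Local Open Scope ring_scope.

(** Write [A], [Al] and [Ar] for the two-sided, left and right conductors of the
    maximal subring [R] in [T].

    The heart of the matter is that [Al] and [Ar] are prime ideals of [R]
    ([colon_l_prime], [colon_r_prime]). If [x R y] lies in [Al], the elements [z]
    of [R] with [x R z] inside [Al] form a left ideal [J] of [R] containing [Al]
    and [y]; the subring of all [t] in [T] with [t J] inside [J] contains [R], so
    by maximality it is [T] or [R], which puts [y] or [x] in [Al]. The right-hand
    version is the same statement in the converse ring.

    On the other hand the product [Al Ar] lies in [A], since
    [T Al Ar T = (T Al) (Ar T)]. So every prime ideal of [R] over [A] contains
    [Al] or [Ar] ([prime_over_colon]), and the minimal primes over [A] are the
    minimal elements of the set formed by [Al] and [Ar]. The prime radical of
    [A], the criteria for [A] to be prime or semiprime, the zero-dimensional case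
    and the statements on nilpotent ideals all follow.

    When [A] is not prime in [T], there are ideals [I] and [J] of [T], not inside
    [A], with [I J] inside [A]. By maximality [R + I = R + J = T], and then
    [J + Al] is an ideal of [T] whose contraction to [R] is [Al]; likewise
    [I + Ar] contracts to [Ar] ([colon_l_lift], [colon_r_lift]). Being
    supplements of [R], these ideals have the residue rings of their
    contractions, and are minimal primes over [A] when [Al] and [Ar] are
    incomparable ([lift_min_primes]).

    Two classical theorems are needed for the chain conditions: the nilpotency of
    the Jacobson radical of a one-sided Artinian ring, and Levitzki's theorem on
    nil ideals of one-sided Noetherian rings. Both are proved on one side, with
    nilpotency read off products of elements, and transferred to the other side
    through the converse ring. *)

(** * Ideals, primes and products in a ring *)

Section IdealTheory.
Variable S : pzRingType.
Implicit Types (I J K L P : set S) (x y z : S).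

Lemma left_ideal_oppr I x : left_ideal I -> I x -> I (- x).
Proof. by move=> [I0 IB _] Ix; rewrite -sub0r; exact: IB. Qed.

Lemma left_ideal_addr I x y : left_ideal I -> I x -> I y -> I (x + y).
Proof.
move=> Iid Ix Iy; have [_ IB _] := Iid.
by rewrite -[y]opprK; apply: IB => //; exact: left_ideal_oppr.
Qed.

Lemma left_ideal_sum I n (f : 'I_n -> S) :
  left_ideal I -> (forall i, I (f i)) -> I (\sum_(i < n) f i).
Proof.
move=> Iid If; elim/big_ind: _ => //; first by case: Iid.
by move=> x y; exact: left_ideal_addr.
Qed.

Lemma left_ideal_eqT I : left_ideal I -> I 1 -> I = setT.
Proof.
move=> [_ _ Il] I1; apply/seteqP; split=> // x _.
by rewrite -[x]mulr1; exact: Il.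
Qed.

Lemma ideal_setT : ideal (setT : set S).
Proof. by split; split. Qed.

Lemma idealI I J : ideal I -> ideal J -> ideal (I `&` J).
Proof.
move=> [[I0 IB Il] [_ _ Ir]] [[J0 JB Jl] [_ _ Jr]].
split; split=> //; try by move=> x y [? ?] [? ?]; split; auto.
- by move=> a x [? ?]; split; auto.
- by move=> a x [? ?]; split; auto.
Qed.

Lemma ideal_sum_ideal I J : ideal I -> ideal J -> ideal (ideal_sum I J).
Proof.
move=> [[I0 IB Il] [_ _ Ir]] [[J0 JB Jl] [_ _ Jr]].
have sum0 : ideal_sum I J 0 by exists 0 => //; exists 0; rewrite ?addr0.
have sumB x y : ideal_sum I J x -> ideal_sum I J y -> ideal_sum I J (x - y).
  move=> [a Ia [b Jb <-]] [c Ic [d Jd <-]].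
  exists (a - c); first exact: IB.
  by exists (b - d); [exact: JB|rewrite opprD addrACA].
split; split=> // s _ [a Ia [b Jb <-]].
  by exists (s * a); [exact: Il|exists (s * b); [exact: Jl|rewrite mulrDr]].
by exists (a * s); [exact: Ir|exists (b * s); [exact: Jr|rewrite mulrDl]].
Qed.

Lemma ideal_prodM I J x y : I x -> J y -> ideal_prod I J (x * y).
Proof.
move=> Ix Jy; exists 1%N, (fun=> x), (fun=> y); split=> //.
by rewrite big_ord1.
Qed.

Lemma ideal_prod_subset I J P : left_ideal P ->
  (forall x y, I x -> J y -> P (x * y)) -> ideal_prod I J `<=` P.
Proof.
move=> Pid IJP _ [n [a [b [Ia Jb ->]]]].
by apply: left_ideal_sum => // i; exact: IJP.
Qed.

Lemma ideal_prod_ideal I J : ideal I -> ideal J -> ideal (ideal_prod I J).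
Proof.
move=> [Il [_ _ Ir]] [Jl [_ _ Jr]]; have [_ _ IM] := Il.
have prod0 : ideal_prod I J 0.
  by exists 0%N, (fun=> 0), (fun=> 0); split; [case|case|rewrite big_ord0].
have prodB x y : ideal_prod I J x -> ideal_prod I J y ->
    ideal_prod I J (x - y).
  move=> [n [a [b [Ia Jb ->]]]] [m [c [d [Ic Jd ->]]]].
  exists (n + m)%N,
    (fun i : 'I_(n + m) =>
      match fintype.split i with inl j => a j | inr j => - c j end),
    (fun i : 'I_(n + m) =>
      match fintype.split i with inl j => b j | inr j => d j end).
  split.
  - by move=> i; case: (fintype.split i) => j //; exact: left_ideal_oppr.
  - by move=> i; case: (fintype.split i).
  - rewrite big_split_ord /= -sumrN; congr (_ + _); apply: eq_bigr => i _.
      by rewrite (unsplitK (inl i)).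
    by rewrite (unsplitK (inr i)) mulNr.
split; split=> // r _ [n [a [b [Ia Jb ->]]]].
- exists n, (fun i => r * a i), b; split=> //.
    by move=> i; exact: IM.
  by rewrite mulr_sumr; apply: eq_bigr => i _; rewrite mulrA.
- exists n, a, (fun i => b i * r); split=> //.
    by move=> i; exact: Jr.
  by rewrite mulr_suml; apply: eq_bigr => i _; rewrite mulrA.
Qed.

Lemma ideal_powSS I n :
  ideal_pow I n.+2 = ideal_prod I (ideal_pow I n.+1).
Proof. by []. Qed.

Lemma ideal_pow_ideal I n : ideal I -> ideal (ideal_pow I n).
Proof.
move=> Iid; elim: n => [|[|n] IHn]; [exact: ideal_setT|exact: Iid|].
by rewrite ideal_powSS; exact: ideal_prod_ideal.
Qed.

(** Multiplicatively, a proper ideal [P] is prime when [x S y] is contained in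
    [P] only if [x] or [y] belongs to [P]. *)
Lemma prime_idealW P : ideal P -> P <> setT ->
  (forall x y, (forall s, P (x * s * y)) -> P x \/ P y) -> prime_ideal P.
Proof.
move=> Pid PT Pxy; split=> // I J [_ [_ _ Ir]] _ IJP.
have [|/existsNP[x /not_implyP[Ix nPx]]] := pselect (I `<=` P); first by left.
right=> y Jy; have [s|//|//] := Pxy x y.
by apply/IJP/ideal_prodM => //; exact: Ir.
Qed.

Lemma prime_idealM P x y : prime_ideal P ->
  (forall s, P (x * s * y)) -> P x \/ P y.
Proof.
move=> [[Pl [_ _ Pr]] _ Pprime] Pxy; have [P0 PB PM] := Pl.
(* J is the largest right factor of x and I the largest left factor of J *)
pose J : set S := [set z | forall s, P (x * s * z)].
pose I : set S := [set w | forall s z, J z -> P (w * s * z)].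
have Jid : ideal J.
  have J0 : J 0 by move=> s; rewrite mulr0.
  have JB u v : J u -> J v -> J (u - v).
    by move=> Ju Jv s; rewrite mulrBr; exact: PB.
  split; split=> // a z Jz s; last by rewrite mulrA; exact: Pr.
  by rewrite mulrA -(mulrA x); exact: Jz.
have Iid : ideal I.
  have I0 : I 0 by move=> s z _; rewrite !mul0r.
  have IB u v : I u -> I v -> I (u - v).
    by move=> Iu Iv s z Jz; rewrite !mulrBl; apply: PB; [exact: Iu|exact: Iv].
  split; split=> // a w Iw s z Jz; last by rewrite -(mulrA w); exact: Iw.
  by rewrite -!mulrA; apply: PM; rewrite mulrA; exact: Iw.
have Ix : I x by move=> s z Jz; exact: Jz.
have [|IP|JP] := Pprime I J Iid Jid; last 2 first.
- by left; exact: IP.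
- by right; exact: JP.
apply: ideal_prod_subset => // w z Iw Jz.
by rewrite -[w]mulr1; exact: Iw.
Qed.

Lemma prime_ideal_pow P I n : prime_ideal P -> ideal I ->
  ideal_pow I n `<=` P -> I `<=` P.
Proof.
move=> Pprime Iid; have [_ _ PP] := Pprime.
elim: n => [PT x _|[//|n] IHn]; first exact: PT.
rewrite ideal_powSS => /PP[//||//|/IHn//]; exact: ideal_pow_ideal.
Qed.

Lemma nilpotent_ideal_sub_prime P I : prime_ideal P -> ideal I ->
  nilpotent_ideal I -> I `<=` P.
Proof.
move=> Pprime Iid [n In0]; apply: (prime_ideal_pow Pprime Iid (n := n)).
by rewrite In0 => x ->; have [[[]]] := Pprime.
Qed.

(** [prod_nil I n] says that every product of [n] elements of [I] vanishes,
    which for an ideal means that its [n]-th power is zero. Unlike powers of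
    ideals, this is visibly the same for a ring and its converse. *)
Definition prod_nil I n : Prop :=
  forall s : seq S, size s = n -> {in s, forall x, I x} ->
    \prod_(x <- s) x = 0.

Lemma prod_nilS I n : prod_nil I n -> prod_nil I n.+1.
Proof.
move=> In [//|x s] [sn] Is; rewrite big_cons In ?mulr0 // => y ys.
by apply: Is; rewrite inE ys orbT.
Qed.

Lemma ideal_pow_prod I n (s : seq S) : size s = n.+1 ->
  {in s, forall x, I x} -> ideal_pow I n.+1 (\prod_(x <- s) x).
Proof.
elim: n s => [[//|x [|//]] _ Is|n IHn [//|x s] [sn] Is].
  by rewrite big_seq1; apply: Is; rewrite inE.
rewrite ideal_powSS big_cons; apply: ideal_prodM.
  by apply: Is; rewrite inE eqxx.
by apply: IHn => // y ys; apply: Is; rewrite inE ys orbT.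
Qed.

Lemma ideal_pow_ann I n x y :
  (forall s : seq S, size s = n.+1 -> {in s, forall z, I z} ->
     x * (\prod_(z <- s) z) * y = 0) ->
  forall z, ideal_pow I n.+1 z -> x * z * y = 0.
Proof.
elim: n x => [|n IHn] x xIy z.
  move=> Iz; have := xIy [:: z]; rewrite big_seq1; apply=> // w.
  by rewrite inE => /eqP ->.
rewrite ideal_powSS => -[m [a [b [Ia Ib ->]]]].
rewrite mulr_sumr mulr_suml big1 // => i _; rewrite mulrA.
apply: IHn (Ib i) => s sn Is; have := xIy (a i :: s).
rewrite big_cons mulrA; apply=> [|w]; first by rewrite /= sn.
by rewrite inE => /orP[/eqP ->|/Is].
Qed.

Lemma prod_nil_nilpotent I n :
  ideal I -> prod_nil I n -> nilpotent_ideal I.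
Proof.
move=> Iid /prod_nilS In; exists n.+1; apply/seteqP; split=> [z Iz|_ ->].
  rewrite -[z]mul1r -[1 * z]mulr1; apply: ideal_pow_ann Iz => s sn Is.
  by rewrite mul1r mulr1 In.
by have [[]] := ideal_pow_ideal n.+1 Iid.
Qed.

End IdealTheory.

Lemma prod_nil_conv (S : pzRingType) (I : set S) n :
  @prod_nil S^c I n -> prod_nil I n.
Proof.
move=> In s sn Is; rewrite -[s]revK -rev_prodr.
by apply: In => [|x]; rewrite ?size_rev ?mem_rev //; exact: Is.
Qed.

(** * Chain conditions *)

(** A nonempty family in which every infinite [r]-chain has two equal consecutive
    terms has an [r]-extremal element: otherwise, iterate a choice of strict
    [r]-successors. *)
Lemma chain_extremal (U : Type) (r : U -> U -> Prop) (F : set U) :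
  (forall u : nat -> U, (forall n, F (u n)) ->
     (forall n, r (u n) (u n.+1)) -> exists n, u n.+1 = u n) ->
  F !=set0 -> exists2 x, F x & forall y, F y -> r x y -> y = x.
Proof.
move=> chain [x0 Fx0]; apply: contrapT => noext.
have step x : exists y, F x -> [/\ F y, r x y & y <> x].
  have [Fx|nFx] := pselect (F x); last by exists x.
  apply: contrapT => nostep; apply: noext; exists x => // y Fy rxy.
  by apply: contrapT => yx; apply: nostep; exists y.
have [f fP] := choice step.
have Fu n : F (iter n f x0) by elim: n => //= n /fP[].
have [|n /= un] := chain (fun n => iter n f x0) Fu.
  by move=> n; have [] := fP _ (Fu n).
by have [_ _] := fP _ (Fu n); apply.
Qed.

Lemma noetherian_maximal (S : pzRingType) (C F : set (set S)) :
  noetherian_for C -> F `<=` C -> F !=set0 ->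
  exists2 I, F I & forall J, F J -> I `<=` J -> J = I.
Proof.
move=> noeth FC; apply: chain_extremal => u Fu incr.
have [n un] := noeth u (fun n => FC _ (Fu n)) incr.
by exists n; exact: un.
Qed.

Lemma artinian_minimal (S : pzRingType) (C F : set (set S)) :
  artinian_for C -> F `<=` C -> F !=set0 ->
  exists2 I, F I & forall J, F J -> J `<=` I -> J = I.
Proof.
move=> art FC; apply: (chain_extremal (r := fun I J => J `<=` I)) => u Fu decr.
have [n un] := art u (fun n => FC _ (Fu n)) decr.
by exists n; exact: un.
Qed.

(** * The Jacobson radical *)

Section Jacobson.
Variable S : pzRingType.
Implicit Types (I J K L M : set S) (x y z : S).

Lemma left_ideal_maximal I : left_ideal I -> ~ I 1 ->
  exists2 M, maximal_left_ideal M & I `<=` M.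
Proof.
move=> Iid I1.
pose P : set (set S) := [set X | left_ideal (I `|` X) /\ ~ (I `|` X) 1].
have [F FP Ftot|A [[Aid A1] Amax]] := @Zorn_bigcup S P.
  have [I0 IB IM] := Iid.
  have FB X x y : F X -> (I `|` X) x -> (I `|` X) y ->
      (I `|` \bigcup_(Y in F) Y) (x - y).
    move=> FX Xx Xy; have [[_ XB _] _] := FP _ FX.
    by have [|] := XB _ _ Xx Xy; [left|right; exists X].
  split; last by move=> [//|[X FX X1]]; have [_] := FP _ FX; apply; right.
  split; first by left.
  - move=> x y [Ix|[X FX Xx]] [Iy|[Y FY Yy]].
    + by left; exact: IB.
    + by apply: (FB Y) => //; [left|right].
    + by apply: (FB X) => //; [right|left].
    + by have [XY|YX] := Ftot _ _ FX FY;
        [apply: (FB Y)|apply: (FB X)] => //; right; auto.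
  - move=> a x [Ix|[X FX Xx]]; first by left; exact: IM.
    have [[_ _ XM] _] := FP _ FX.
    by have [||] := XM a x; [right|left|right; exists X].
exists (I `|` A) => //; split=> //; first by move=> IA; apply: A1; rewrite IA.
move=> K Kid AK; have [K1|nK1] := pselect (K 1).
  by right; exact: left_ideal_eqT.
left; have IK : I `|` K = K by apply/setUidPr => x Ix; apply: (AK x); left.
apply: contrapT => nKA.
have AK' : A `<` K.
  split; first by move=> x Ax; apply: AK; right.
  by move=> KA; apply: nKA; apply/seteqP; split=> // x /KA; right.
by case: (Amax K AK'); split; rewrite IK.
Qed.

Lemma jacobson_left_ideal : left_ideal (jacobson S).
Proof.
split=> [M [[]]//|x y Jx Jy M Mmax|a x Jx M Mmax].
  by have [[_ MB _] _ _] := Mmax; apply: MB; [exact: Jx|exact: Jy].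
by have [[_ _ MM] _ _] := Mmax; apply: MM; exact: Jx.
Qed.

Lemma jacobson_ideal : ideal (jacobson S).
Proof.
have Jl := jacobson_left_ideal; have [J0 JB _] := Jl.
split=> //; split=> // a x Jx M Mmax; have [Mid MT Mext] := Mmax.
have [M0 MB MM] := Mid.
have [Ma|nMa] := pselect (M a); first exact: MM.
(* x belongs to M : a, which is a maximal left ideal when a is not in M *)
apply: (Jx [set y | M (y * a)]); split.
- split=> [|y z|b y]; rewrite /= ?mul0r ?mulrBl -?mulrA; [by []|exact: MB|].
  exact: MM.
- by move=> MaT; apply: nMa; rewrite -[a]mul1r; have : setT (1 : S) by [];
    rewrite -MaT.
move=> K Kid MaK; have [_ KB KM] := Kid.
have [KMa|/existsNP[k /not_implyP[Kk nMk]]] :=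
    pselect (K `<=` [set y | M (y * a)]).
  by left; apply/seteqP; split.
right; pose N : set S := [set z | exists2 y, K y & M (z - y * a)].
have Nid : left_ideal N.
  split.
  - by exists 0; [case: Kid|rewrite mul0r subrr].
  - move=> u v [y Ky My] [z Kz Mz]; exists (y - z); first exact: KB.
    have -> : u - v - (y - z) * a = (u - y * a) - (v - z * a).
      by rewrite mulrBl !opprB addrACA [RHS]addrACA [- v + _]addrC.
    exact: MB.
  - move=> b u [y Ky My]; exists (b * y); first exact: KM.
    by rewrite -mulrA -mulrBr; exact: MM.
have [|NM|NT] := Mext N Nid.
- by move=> z Mz; exists 0; [case: Kid|rewrite mul0r subr0].
- by case: nMk; rewrite /= -NM; exists k => //; rewrite subrr.
- apply: left_ideal_eqT => //.
  have : setT a by []; rewrite -NT => -[y Ky].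
  rewrite -[X in X - _]mul1r -mulrBl => /MaK K1y.
  by rewrite -[1](subrK y); exact: left_ideal_addr.
Qed.

Lemma jacobson_left_inverse x : jacobson S x -> exists u, u * (1 - x) = 1.
Proof.
move=> Jx; pose L : set S := [set y | exists u, y = u * (1 - x)].
have Lid : left_ideal L.
  split; first by exists 0; rewrite mul0r.
  - by move=> _ _ [u ->] [v ->]; exists (u - v); rewrite mulrBl.
  - by move=> a _ [u ->]; exists (a * u); rewrite mulrA.
have [[u u1]|nL1] := pselect (L 1); first by exists u.
have [M Mmax LM] := left_ideal_maximal Lid nL1.
have [Mid MT _] := Mmax; case: MT; apply: left_ideal_eqT => //.
rewrite -[1](subrK x); apply: left_ideal_addr; [exact: Mid| |exact: Jx].
by apply: LM; exists 1; rewrite mul1r.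
Qed.

Lemma jacobson_right_inverse x : jacobson S x -> exists u, (1 - x) * u = 1.
Proof.
move=> Jx; have [u ux1] := jacobson_left_inverse Jx.
have [v vu1] : exists v, v * u = 1.
  have -> : u = 1 - (- u * x).
    by apply/eqP; rewrite mulNr opprK -subr_eq -ux1 mulrBr mulr1.
  apply: jacobson_left_inverse; have [_ _ JM] := jacobson_left_ideal.
  exact: JM.
exists u; suff -> : 1 - x = v by [].
by have := mulrA v u (1 - x); rewrite ux1 vu1 mul1r mulr1.
Qed.

(** Let [K] be the right annihilator of a stationary power of [I]: no nonzero
    element of [S / K] is killed by [I]. If [K] were proper, a minimal left ideal
    strictly above [K] would contain some [x] outside [K] with [x = w * j * x]
    modulo [K] for a [j] in [I], which the left inverse of [1 - w * j] forbids.
    Hence [K = S], and the power vanishes. *)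
Lemma left_artinian_prod_nil I : ideal I ->
  (forall x, I x -> exists u, u * (1 - x) = 1) ->
  left_artinian S -> exists n, prod_nil I n.
Proof.
move=> Iid Iinv art; have [_ [_ _ Ir]] := Iid; have [[_ _ Il] _] := Iid.
pose P n := ideal_pow I n.+1.
have Pid n : ideal (P n) by exact: ideal_pow_ideal.
have [||n Pn] := art P; first by move=> n; case: (Pid n).
  move=> n; rewrite /P ideal_powSS.
  apply: ideal_prod_subset; first by case: (Pid n).
  by move=> x y _; have [[_ _ PM] _] := Pid n; exact: PM.
exists n.+1; pose K : set S := [set y | forall z, P n z -> z * y = 0].
have Kid : left_ideal K.
  split=> [z _|x y Kx Ky z Pz|a x Kx z Pz]; first by rewrite mulr0.
    by rewrite mulrBr Kx ?Ky ?subrr.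
  by rewrite mulrA Kx //; have [_ [_ _]] := Pid n; apply.
have KI y : (forall j, I j -> K (j * y)) -> K y.
  move=> Ky z; rewrite -(Pn n.+1) // => Pz; rewrite -[z]mul1r.
  apply: ideal_pow_ann Pz => s; case/lastP: s => [//|s j].
  rewrite size_rcons => -[sn] Is; rewrite mul1r -cats1 big_cat big_seq1 -mulrA.
  apply: Ky; first by apply: Is; rewrite mem_rcons inE eqxx.
  by apply: ideal_pow_prod => // w ws; apply: Is; rewrite mem_rcons inE ws orbT.
have [K1|nK1] := pselect (K 1).
  by move=> s sn Is; rewrite -[LHS]mulr1; apply: K1; exact: ideal_pow_prod.
pose F : set (set S) :=
  [set L | [/\ left_ideal L, K `<=` L & exists2 x, L x & ~ K x]].
have [||L [Lid KL [x Lx nKx]] Lmin] := artinian_minimal (F := F) art.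
- by move=> L [].
- by exists setT; split=> //; exists 1.
exfalso; have [_ LB LM] := Lid; have [_ KB KM] := Kid.
have [/KI//|/existsNP[j /not_implyP[Ij nKj]]] :=
  pselect (forall j, I j -> K (j * x)).
pose L' : set S := [set y | exists w, K (y - w * (j * x))].
have : L' = L.
  apply: Lmin.
  - split.
    + split; first by exists 0; rewrite mul0r subr0; case: Kid.
      * move=> u v [a Ka] [b Kb]; exists (a - b).
        have -> : u - v - (a - b) * (j * x) =
            (u - a * (j * x)) - (v - b * (j * x)).
          by rewrite mulrBl !opprB addrACA [RHS]addrACA [- v + _]addrC.
        exact: KB.
      * move=> b u [a Ka]; exists (b * a); rewrite -mulrA -mulrBr; exact: KM.
    + by move=> y Ky; exists 0; rewrite mul0r subr0.
    + by exists (j * x) => //; exists 1; rewrite mul1r subrr; case: Kid.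
  - move=> y [w /KL Ly]; rewrite -[y](subrK (w * (j * x))).
    by apply: left_ideal_addr => //; apply/LM/LM.
move=> L'L; move: Lx; rewrite -L'L => -[w Kw]; apply: nKx.
have [u u1] := Iinv (w * j) (Il _ _ Ij).
rewrite -[x]mul1r -u1 -mulrA; apply: KM.
by rewrite mulrBl mul1r -mulrA.
Qed.

End Jacobson.

Lemma artinian_jacobson_nilpotent (S : pzRingType) :
  left_artinian S \/ right_artinian S -> nilpotent_ideal (jacobson S).
Proof.
have Jid := @jacobson_ideal S; case=> art.
  have [n Jn] := left_artinian_prod_nil Jid (@jacobson_left_inverse S) art.
  exact: prod_nil_nilpotent Jn.
have [Jl Jr] := Jid.
have [n /prod_nil_conv Jn] := @left_artinian_prod_nil S^c (jacobson S)
  (conj Jr Jl) (@jacobson_right_inverse S) art.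
exact: prod_nil_nilpotent Jn.
Qed.

(** * Nil ideals in Noetherian rings *)

Section NilIdeals.
Variable S : pzRingType.
Implicit Types (I J W N : set S) (x y z : S).

Lemma prod_nil_square W I n : (forall x y, I x -> I y -> W (x * y)) ->
  prod_nil W n -> prod_nil I n.*2.
Proof.
move=> IW Wn s sn Is.
have [t [tn Wt ->]] : exists t : seq S, [/\ size t = n,
    {in t, forall x, W x} & \prod_(x <- s) x = \prod_(x <- t) x].
  elim: n s sn Is {Wn} => [[|//] _ _|n IHn [//|x [//|y s]] [sn] Is].
    by exists [::].
  have [z zs|t [tn Wt st]] := IHn s sn.
    by apply: Is; rewrite !inE zs !orbT.
  exists (x * y :: t); split=> /=; first by rewrite tn.
    move=> z; rewrite inE => /orP[/eqP ->|/Wt//].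
    by apply: IW; apply: Is; rewrite !inE eqxx ?orbT.
  by rewrite !big_cons st mulrA.
exact: Wn.
Qed.

(** Levitzki's theorem, by Utumi's argument: if [W] is a maximal nilpotent ideal
    inside the nil ideal [N] and [a] in [N] outside [W] has a maximal right
    annihilator modulo [W], then [a S a] lies in [W], so that [a] belongs to a
    larger nilpotent ideal inside [N]. *)
Lemma right_noetherian_prod_nil N :
  right_noetherian S -> nil_ideal N -> exists n, prod_nil N n.
Proof.
move=> noeth [Nid Nnil]; have [[N0 NB Nl] [_ _ Nr]] := Nid.
pose F : set (set S) :=
  [set W | [/\ ideal W, W `<=` N & exists n, prod_nil W n]].
have [||W [Wid WN [n Wn]] Wmax] := noetherian_maximal (F := F) noeth.
- by move=> W [[]].
- exists [set 0]; split=> [|_ -> //|].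
    by split; split=> // [x y -> ->|a x ->]; rewrite ?subrr ?mulr0 ?mul0r.
  exists 1%N => -[//|x [|//]] _ Is; rewrite big_seq1.
  by apply: Is; rewrite inE.
have [[W0 WB Wl] [_ _ Wr]] := Wid.
have [NW|/existsNP[a0 /not_implyP[Na0 nWa0]]] := pselect (N `<=` W).
  by exists n => s sn Ns; apply: Wn => // x /Ns/NW.
exfalso; pose r a : set S := [set x | W (a * x)].
have [||_ [a [Na nWa] <-] amax] :=
    noetherian_maximal (F := [set r a | a in N `\` W]) noeth.
- move=> _ [a _ <-]; split=> [|x y|b x]; rewrite /r /= ?mulr0 ?mulrBr ?mulrA;
    [by []|exact: WB|exact: Wr].
- by exists (r a0); exists a0.
have aSa x : W (a * x * a).
  have [Wxa|nWxa] := pselect (W (x * a)).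
    by rewrite -mulrA; exact: Wl.
  have [m xam] := Nnil _ (Nl x a Na).
  (* k.+1 is the largest exponent for which (x a)^(k.+1) is not in W *)
  have [k [nWk Wk]] : exists k, ~ W ((x * a) ^+ k.+1) /\ W ((x * a) ^+ k.+2).
    apply: contrapT => nok; have : W ((x * a) ^+ m.+1).
      by rewrite exprS xam mulr0.
    elim: m {xam} => [|m IHm]; first by rewrite expr1.
    move=> Wm; apply: IHm; apply: contrapT => nWm.
    by apply: nok; exists m.
  have rk : r ((x * a) ^+ k.+1) = r a.
    apply: amax.
      exists ((x * a) ^+ k.+1) => //; split=> //.
      by rewrite exprS; apply/Nr/Nl.
    move=> y ay; rewrite /r /= exprSr -!mulrA; apply/Wl/Wl; exact: ay.
  have : r ((x * a) ^+ k.+1) (x * a) by rewrite /r /= -exprSr.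
  by rewrite rk /r /= mulrA.
pose Y : set S := [set y | N y /\ forall s, W (a * s * y)].
pose V : set S := [set z | Y z /\ forall s y, Y y -> W (z * s * y)].
have Yid : ideal Y.
  have Y0 : Y 0 by split=> // s; rewrite mulr0.
  have YB y z : Y y -> Y z -> Y (y - z).
    move=> [Ny Wy] [Nz Wz]; split; first exact: NB.
    by move=> s; rewrite mulrBr; exact: WB.
  split; split=> // b y [Ny Wy]; split; [exact: Nl| |exact: Nr|] => s.
    by rewrite mulrA -(mulrA a); exact: Wy.
  by rewrite mulrA; exact: Wr.
have [[Y0 YB Yl] [_ _ Yr]] := Yid.
have Vid : ideal V.
  have V0 : V 0 by split=> // s y _; rewrite !mul0r.
  have VB y z : V y -> V z -> V (y - z).
    move=> [Yy Wy] [Yz Wz]; split; first exact: YB.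
    by move=> s w Yw; rewrite !mulrBl; apply: WB; [exact: Wy|exact: Wz].
  split; split=> // b y [Yy Wy]; split; [exact: Yl| |exact: Yr|] => s w Yw.
    by rewrite -!mulrA; apply: Wl; rewrite mulrA; exact: Wy.
  by rewrite -(mulrA y); exact: Wy.
have WY : W `<=` Y by move=> w Ww; split=> [|s]; [exact: WN|exact: Wl].
have WV : W `<=` V.
  by move=> w Ww; split=> [|s y _]; [exact: WY|apply/Wr/Wr].
have Va : V a by split=> [|s y [_]]; [split=> // s; exact: aSa|apply].
apply: nWa; rewrite -(Wmax V) //; split=> //; first by move=> v [[]].
exists n.*2; apply: prod_nil_square Wn => x y [_ Vx] [Yy _].
by rewrite -[x]mulr1; exact: Vx.
Qed.

End NilIdeals.

Lemma noetherian_upper_nilradical_nilpotent (S : pzRingType) :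
  left_noetherian S \/ right_noetherian S ->
  nilpotent_ideal (upper_nilradical S).
Proof.
have [nilN _] := @upper_nilradicalP S; have [Nid Nnil] := nilN.
case=> noeth; last first.
  have [n Nn] := right_noetherian_prod_nil noeth nilN.
  exact: prod_nil_nilpotent Nn.
have [Nl Nr] := Nid.
have [|n /prod_nil_conv Nn] :=
    @right_noetherian_prod_nil S^c (upper_nilradical S) noeth.
  split; first by split.
  by move=> x /Nnil[n xn]; exists n; rewrite revrX.
exact: prod_nil_nilpotent Nn.
Qed.

(** * Quotients *)

Lemma quot_ring_isomorphic (S S' : pzRingType) (I : two_sided_ideal S)
    (I' : two_sided_ideal S') (f : {rmorphism S -> S'}) :
  (forall x, ideal_set I x <-> ideal_set I' (f x)) ->
  (forall y, exists x, ideal_set I' (y - f x)) ->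
  ring_isomorphic (quot_ring I) (quot_ring I').
Proof.
move=> ff fsurj.
pose g (q : quot_ring I) : quot_ring I' := quot_pi I' (f (repr q)).
have gE x : g (quot_pi I x) = quot_pi I' (f x).
  by apply/quot_piE; rewrite -rmorphB; apply/ff/quot_piE; rewrite quot_piK.
have gB : zmod_morphism g.
  move=> p q; rewrite -[p]quot_piK -[q]quot_piK.
  have quot_piB (R : pzRingType) (K : two_sided_ideal R) x y :
      quot_pi K x - quot_pi K y = quot_pi K (x - y).
    by apply/eqP; rewrite subr_eq quot_piD subrK.
  by rewrite quot_piB !gE quot_piB rmorphB.
have gM : monoid_morphism g.
  split; first by rewrite [LHS]gE rmorph1.
  move=> p q; rewrite -[p]quot_piK -[q]quot_piK.
  by rewrite [_ * _]quot_piM !gE [RHS]quot_piM rmorphM.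
pose gadd := GRing.isZmodMorphism.Build _ _ g gB.
pose gmul := GRing.isMonoidMorphism.Build _ _ g gM.
pose h : {rmorphism quot_ring I -> quot_ring I'} := HB.pack g gadd gmul.
exists h; change (bijective g).
have ginj : injective g.
  move=> p q; rewrite -[p]quot_piK -[q]quot_piK !gE => /quot_piE.
  by rewrite -rmorphB => /ff/quot_piE.
have gsurj q : exists p, g p = q.
  have [x Ix] := fsurj (repr q); exists (quot_pi I x).
  by rewrite gE -[RHS]quot_piK; apply/esym/quot_piE.
have [k gk] := choice gsurj.
by exists k => // p; apply: ginj; rewrite gk.
Qed.

Section LeftQuotient.
Variables (S : pzRingType) (L : set S) (Lid : left_ideal L).

(** The left module [S / L] of a left ideal [L]; the proof that [L] is a left
    ideal is an argument of the predicate on which the quotient is built, for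
    the instances to depend on it. *)
Definition left_ideal_pred of left_ideal L : {pred S} := fun x => x \in L.

Lemma left_ideal_pred_zmod : zmod_closed (left_ideal_pred Lid).
Proof.
have [L0 LB _] := Lid; split; first exact: mem_set.
by move=> x y /set_mem Lx /set_mem Ly; apply: mem_set; exact: LB.
Qed.

HB.instance Definition _ :=
  GRing.isZmodClosed.Build S (left_ideal_pred Lid) left_ideal_pred_zmod.

Definition left_quot : Type := {ideal_quot (left_ideal_pred Lid)}.

HB.instance Definition _ := GRing.Zmodule.on left_quot.
HB.instance Definition _ := EqQuotient.on left_quot.

Local Open Scope quotient_scope.

Definition left_quot_pi (x : S) : left_quot :=
  \pi_({ideal_quot (left_ideal_pred Lid)}) x.

Definition left_quot_scale (a : S) (x : left_quot) : left_quot :=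
  left_quot_pi (a * repr x).

Lemma left_quot_piE x y : left_quot_pi x = left_quot_pi y <-> L (x - y).
Proof.
have -> : L (x - y) <-> x - y \in left_ideal_pred Lid
  by split=> [Lxy|Lxy]; [exact: mem_set|exact: set_mem].
by rewrite Quotient.idealrBE; split=> /eqP.
Qed.

Lemma left_quot_piK (x : left_quot) : left_quot_pi (repr x) = x.
Proof. exact: (@reprK _ {ideal_quot (left_ideal_pred Lid)}). Qed.

Lemma left_quot_piD x y : left_quot_pi x + left_quot_pi y = left_quot_pi (x + y).
Proof.
by rewrite [RHS](raddfD (\pi_({ideal_quot (left_ideal_pred Lid)}))).
Qed.

Lemma left_quot_piZ a x : left_quot_scale a (left_quot_pi x) = left_quot_pi (a * x).
Proof.
have [_ _ LM] := Lid; apply/left_quot_piE; rewrite -mulrBr; apply: LM.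
by apply/left_quot_piE; exact: left_quot_piK.
Qed.

Lemma left_quot_scaleA a b x :
  left_quot_scale a (left_quot_scale b x) = left_quot_scale (a * b) x.
Proof. by rewrite -[x]left_quot_piK !left_quot_piZ mulrA. Qed.

Lemma left_quot_scale1 : left_id 1 left_quot_scale.
Proof. by move=> x; rewrite -[x]left_quot_piK left_quot_piZ mul1r. Qed.

Lemma left_quot_scaleDr : right_distributive left_quot_scale +%R.
Proof.
move=> a x y; rewrite -[x]left_quot_piK -[y]left_quot_piK.
by rewrite left_quot_piD !left_quot_piZ left_quot_piD mulrDr.
Qed.

Lemma left_quot_scaleDl x : {morph left_quot_scale^~ x : a b / a + b}.
Proof.
move=> a b; rewrite -[x]left_quot_piK.
by rewrite !left_quot_piZ left_quot_piD mulrDl.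
Qed.

HB.instance Definition _ := GRing.Zmodule_isLmodule.Build S left_quot
  left_quot_scaleA left_quot_scale1 left_quot_scaleDr left_quot_scaleDl.

End LeftQuotient.

Lemma maximal_left_ideal_primitive (S : pzRingType) (L : set S) :
  maximal_left_ideal L -> left_primitive_ideal [set x | forall t, L (x * t)].
Proof.
move=> [Lid LT Lmax]; have [L0 LB LM] := Lid.
have piZ a x : a *: left_quot_pi Lid x = left_quot_pi Lid (a * x).
  exact: left_quot_piZ.
have pi0 : left_quot_pi Lid 0 = 0.
  by apply: (addrI (left_quot_pi Lid 0)); rewrite left_quot_piD !addr0.
exists (left_quot Lid : lmodType S); last first.
  apply/seteqP; split=> [x Lx m|x xm t].
    by rewrite -[m]left_quot_piK piZ -pi0; apply/left_quot_piE; rewrite subr0.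
  have := xm (left_quot_pi Lid t); rewrite piZ -pi0 => /left_quot_piE.
  by rewrite subr0.
split=> [|N N0 ND NZ].
  exists (left_quot_pi Lid 1); apply/eqP; rewrite -pi0 => /left_quot_piE.
  by rewrite subr0 => L1; apply: LT; exact: left_ideal_eqT.
(* submodules of S / L correspond to left ideals of S above L *)
pose K : set S := [set x | N (left_quot_pi Lid x)].
have Kid : left_ideal K.
  split; rewrite /K /= ?pi0 //; last by move=> a x Kx; rewrite -piZ; exact: NZ.
  move=> x y Kx Ky; rewrite -left_quot_piD; apply: ND => //.
  by rewrite -mulN1r -piZ; exact: NZ.
have [|KL|KT] := Lmax K Kid.
- move=> x Lx; rewrite /K /=.
  suff -> : left_quot_pi Lid x = 0 by [].
  by rewrite -pi0; apply/left_quot_piE; rewrite subr0.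
- left; apply/seteqP; split=> [m|_ -> //]; rewrite -[m]left_quot_piK => Nm.
  rewrite /= -pi0; apply/left_quot_piE; rewrite subr0.
  by have : K (repr m) by []; rewrite KL.
- right; apply/seteqP; split=> // m _; rewrite -[m]left_quot_piK.
  by have : K (repr m) by rewrite KT.
Qed.

(** * Maximal subrings *)

Section ConverseSubring.
Variables (T : nzRingType) (R : subringClosed T).

(** The same subring, inside the converse ring; it exchanges [colon_l] and
    [colon_r]. *)
Definition conv_pred : {pred T^c} := fun x => (x : T) \in R.

Lemma conv_pred_subring : subring_closed conv_pred.
Proof.
split; first exact: (rpred1 R).
- by move=> x y; exact: (@rpredB T R).
- by move=> x y Rx Ry; exact: (@rpredM T R).
Qed.

HB.instance Definition _ :=
  GRing.isSubringClosed.Build T^c conv_pred conv_pred_subring.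

Definition conv_subring : subringClosed T^c := conv_pred.

End ConverseSubring.

Section MaximalSubringTheory.
Variables (T : nzRingType) (R : subringClosed T).
Hypothesis maxR : maximal_subring R.

Let A := colon R.
Let Al := colon_l R.
Let Ar := colon_r R.
Let RA := inter_subring R A.
Let RAl := inter_subring R Al.
Let RAr := inter_subring R Ar.

Lemma maximal_subring_overring (X : set T) :
  X 1 -> (forall x y, X x -> X y -> X (x - y)) ->
  (forall x y, X x -> X y -> X (x * y)) ->
  [set` R] `<=` X -> X `<=` [set` R] \/ X = setT.
Proof.
move=> X1 XB XM RX; have [_ noS] := maxR.
pose p : {pred T} := fun x => x \in X.
have pP : subring_closed p.
  split; first exact: mem_set.
  - by move=> x y /set_mem Xx /set_mem Xy; apply: mem_set; exact: XB.
  - by move=> x y /set_mem Xx /set_mem Xy; apply: mem_set; exact: XM.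
pose S : subringClosed T := HB.pack p (GRing.isSubringClosed.Build T p pP).
have SE : [set` S] = X.
  by apply/seteqP; split=> x; [move/set_mem|move=> Xx; exact: mem_set].
have [|nXR] := pselect (X `<=` [set` R]); first by left.
right; apply: contrapT => nXT; apply: noS; exists S; rewrite SE; split=> //.
by split=> // TX; apply: nXT; apply/seteqP.
Qed.

Lemma maximal_subring_proper : exists t, t \notin R.
Proof.
have [[_ nTR] _] := maxR; have /existsNP[t /not_implyP[_ /negP tR]] := nTR.
by exists t.
Qed.

Lemma conv_maximal_subring : maximal_subring (conv_subring R).
Proof.
have [RT noS] := maxR; split; first exact: RT.
move=> [S [RS ST]]; apply: noS.
pose p : {pred T} := fun x => (x : T^c) \in S.
have pP : subring_closed p.
  split; first exact: (rpred1 S).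
  - by move=> x y; exact: (@rpredB T^c S).
  - by move=> x y Sx Sy; exact: (@rpredM T^c S).
pose S' : subringClosed T := HB.pack p (GRing.isSubringClosed.Build T p pP).
by exists S'.
Qed.

Lemma colon_lM t x : Al x -> Al (t * x).
Proof. by move=> Alx s; rewrite mulrA; exact: Alx. Qed.

Lemma colon_lMr x r : Al x -> r \in R -> Al (x * r).
Proof. by move=> Alx Rr s; rewrite mulrA rpredM //; exact: Alx. Qed.

Lemma colon_lB x y : Al x -> Al y -> Al (x - y).
Proof.
by move=> Alx Aly s; rewrite mulrBr; apply: rpredB; [exact: Alx|exact: Aly].
Qed.

Lemma colon_l_left_ideal : left_ideal Al.
Proof.
split; [by move=> t; rewrite mulr0 rpred0|exact: colon_lB|].
by move=> t x; exact: colon_lM.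
Qed.

Lemma colon_l_sub : Al `<=` [set` R].
Proof. by move=> x Alx; rewrite /= -[x]mul1r; exact: Alx. Qed.

Lemma colon_r_sub : Ar `<=` [set` R].
Proof. by move=> x Arx; rewrite /= -[x]mulr1; exact: Arx. Qed.

Lemma colon_sub_l : A `<=` Al.
Proof. by move=> x Ax t; rewrite -[_ * _]mulr1; exact: Ax. Qed.

Lemma colon_sub_r : A `<=` Ar.
Proof. by move=> x Ax t; rewrite -[x]mul1r; exact: Ax. Qed.

Lemma colon_sub : A `<=` [set` R].
Proof. by move=> x /colon_sub_l/colon_l_sub. Qed.

Lemma colon_ideal : ideal A.
Proof.
have A0 : A 0 by move=> a b; rewrite mulr0 mul0r rpred0.
have AB x y : A x -> A y -> A (x - y).
  by move=> Ax Ay a b; rewrite mulrBr mulrBl; apply: rpredB; [exact: Ax|exact: Ay].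
split; split=> // a x Ax b c; first by rewrite mulrA; exact: Ax.
by rewrite mulrA -mulrA; exact: Ax.
Qed.

(** [A] is the largest ideal of [T] inside [R]. *)
Lemma ideal_sub_colon (I : set T) : ideal I -> I `<=` [set` R] -> I `<=` A.
Proof.
by move=> [[_ _ Il] [_ _ Ir]] IR x Ix a b; apply: IR; apply/Ir/Il.
Qed.

Lemma colon_proper : A <> setT.
Proof.
have [t /negP tR] := maximal_subring_proper.
by move=> AT; apply: tR; apply: colon_sub; rewrite AT.
Qed.

Lemma colon_lrM x y : Al x -> Ar y -> A (x * y).
Proof.
move=> Alx Ary a b; rewrite mulrA -mulrA.
by apply: rpredM; [exact: Alx|exact: Ary].
Qed.

Lemma colon_comparable_l : Al `<=` Ar <-> A = Al.
Proof.
split=> [lr|<-]; last exact: colon_sub_r.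
apply/seteqP; split; first exact: colon_sub_l.
by move=> x Alx a; apply: lr; exact: colon_lM.
Qed.

(** Let [J] be the set of all [z] in [R] such that [x R z] lies in [Al]. The ring
    of all [t] in [T] with [t J] inside [J] contains [R]. If it is [T], then
    [T J] lies in [R], so [y] is in [Al]; if it is [R], then [x] is in [Al],
    because [T x J] lies in [Al], which is part of [J]. *)
Lemma colon_l_primeM x y : x \in R -> y \in R ->
  (forall r, r \in R -> Al (x * r * y)) -> Al x \/ Al y.
Proof.
move=> Rx Ry xRy.
pose J : set T := [set z | z \in R /\ forall r, r \in R -> Al (x * r * z)].
have JB u v : J u -> J v -> J (u - v).
  move=> [Ru Ju] [Rv Jv]; split; first exact: rpredB.
  by move=> r Rr; rewrite mulrBr; apply: colon_lB; [exact: Ju|exact: Jv].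
pose X : set T := [set t | forall z, J z -> J (t * z)].
have [||||XR|XT] := maximal_subring_overring (X := X).
- by move=> z Jz; rewrite mul1r.
- by move=> s t Xs Xt z Jz; rewrite mulrBl; apply: JB; [exact: Xs|exact: Xt].
- by move=> s t Xs Xt z Jz; rewrite -mulrA; exact/Xs/Xt.
- move=> r /= Rr z [Rz Jz]; split; first exact: rpredM.
  by move=> s Rs; rewrite mulrA -(mulrA x); apply: Jz; exact: rpredM.
- left=> t; apply: XR => z [Rz Jz].
  have Alxz : Al (t * x * z).
    by rewrite -mulrA; apply: colon_lM; rewrite -[x]mulr1; apply: Jz; exact: rpred1.
  split; first exact: colon_l_sub.
  by move=> r Rr; exact: colon_lM.
- right=> t; have : X t by rewrite XT.
  by move=> /(_ y) []; first by split.
Qed.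

Lemma inter_subringS (X Y : set T) : X `<=` [set` R] ->
  inter_subring R X `<=` inter_subring R Y -> X `<=` Y.
Proof. by move=> XR XY x Xx; exact: (XY (Subring (XR _ Xx))). Qed.

Lemma inter_subring_inj (X Y : set T) : X `<=` [set` R] -> Y `<=` [set` R] ->
  inter_subring R X = inter_subring R Y -> X = Y.
Proof.
move=> XR YR XY; apply/seteqP.
by split; apply: inter_subringS => //; rewrite XY.
Qed.

Lemma colon_l_prime : prime_ideal RAl.
Proof.
apply: prime_idealW; first exact: colon_l_idealP.
- have [t /negP tR] := maximal_subring_proper.
  move=> RT; apply: tR; have : RAl 1 by rewrite RT.
  by move=> /(_ t); rewrite /= mulr1.
- move=> x y xRy; apply: colon_l_primeM; [exact: valP|exact: valP|].
  by move=> r Rr; exact: (xRy (Subring Rr)).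
Qed.

(** Every ideal of [T] outside [A] supplements [R]. *)
Lemma ideal_supplement (I : set T) : ideal I -> ~ I `<=` A ->
  forall t, exists2 r, r \in R & I (t - r).
Proof.
move=> Iid nIA; have [Il [_ _ Ir]] := Iid; have [I0 IB IM] := Il.
pose X : set T := [set t | exists2 r, r \in R & I (t - r)].
have [||||XR|XT] := maximal_subring_overring (X := X).
- by exists 1; rewrite ?rpred1 ?subrr.
- move=> s t [r Rr Ir1] [u Ru Iu]; exists (r - u); first exact: rpredB.
  have -> : s - t - (r - u) = (s - r) - (t - u).
    by rewrite !opprB addrACA [RHS]addrACA [- t + _]addrC.
  exact: IB.
- move=> s t [r Rr Ir1] [u Ru Iu]; exists (r * u); first exact: rpredM.
  have -> : s * t - r * u = (s - r) * t + r * (t - u).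
    by rewrite mulrBl mulrBr addrA subrK.
  by apply: left_ideal_addr => //; [exact: Ir|exact: IM].
- by move=> r Rr; exists r => //; rewrite subrr.
- case: nIA; apply: ideal_sub_colon => // x Ix; apply: XR.
  by exists 0; rewrite ?rpred0 ?subr0.
- by move=> t; have : X t by rewrite XT.
Qed.

(** If the product of the ideals [I] and [J] of [T] lies in [A] and both
    supplement [R], then [J + Al] is an ideal of [T] contracting to [Al]. *)
Lemma colon_l_lift (I J : set T) : ideal J ->
  (forall x y, I x -> J y -> A (x * y)) ->
  (forall t, exists2 r, r \in R & I (t - r)) ->
  (forall t, exists2 r, r \in R & J (t - r)) ->
  exists Q : set T, [/\ ideal Q, J `<=` Q & Q `&` [set` R] = Al].
Proof.
move=> [Jl [_ _ Jr]] IJA Isup Jsup; have [J0 JB JM] := Jl.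
have [Al0 _ _] := colon_l_left_ideal.
pose Q : set T := [set x | exists2 a, Al a & J (x - a)].
have JQ : J `<=` Q by move=> x Jx; exists 0 => //; rewrite subr0.
have QB x y : Q x -> Q y -> Q (x - y).
  move=> [a Ala Jx] [b Alb Jy]; exists (a - b); first exact: colon_lB.
  have -> : x - y - (a - b) = (x - a) - (y - b).
    by rewrite !opprB addrACA [RHS]addrACA [- y + _]addrC.
  exact: JB.
have JR x : J x -> x \in R -> Al x.
  move=> Jx Rx t; have [r Rr Itr] := Isup t.
  rewrite -[t](subrK r) mulrDl rpredD //; last exact: rpredM.
  by apply: colon_sub; exact: IJA.
exists Q; split=> //.
  split; split=> //; [exact: JQ| |exact: JQ|] => t x [a Ala Jx].
    by exists (t * a); [exact: colon_lM|rewrite -mulrBr; exact: JM].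
  have [r Rr Jtr] := Jsup t; exists (a * r); first exact: colon_lMr.
  have -> : x * t - a * r = (x - a) * t + a * (t - r).
    by rewrite mulrBl mulrBr addrA subrK.
  by apply: left_ideal_addr => //; [exact: Jr|exact: JM].
apply/seteqP; split=> [x [[a Ala Jx] /= Rx]|x Alx].
  rewrite -[x](subrK a); apply: (left_ideal_addr colon_l_left_ideal) => //.
  by apply: JR => //; apply: rpredB => //; exact: colon_l_sub.
by split; [exists x => //; rewrite subrr|exact: colon_l_sub].
Qed.

Section Lift.
Variables (Q L : set T).
Hypotheses (Qid : ideal Q) (QRL : Q `&` [set` R] = L).
Hypothesis Qsup : forall t, exists2 r, r \in R & Q (t - r).

Lemma lift_quot_isomorphic (I : two_sided_ideal (subring R)) :
  ideal_set I = inter_subring R L ->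
  ring_isomorphic (quot_ring I) (quot_ring (TwoSidedIdeal Qid)).
Proof.
move=> IL; apply: (@quot_ring_isomorphic _ _ _ _ (val : {rmorphism _ -> _})).
  by move=> x; rewrite IL /inter_subring /= -QRL; split=> [[]|] //; split=> //; exact: valP.
by move=> t; have [r Rr Qtr] := Qsup t; exists (Subring Rr).
Qed.

(** An ideal of [T] that supplements [R] has the same residue ring as its
    contraction to [R], so each is prime as soon as the other is. Two such
    ideals, one inside the other, are equal if their contractions are, by the
    modular law. As [A] is not prime, every prime of [T] over [A] supplements
    [R]. *)
Lemma lift_min_primes :
  min_primes RA (inter_subring R L) -> ~ prime_ideal A -> min_primes A Q.
Proof.
move=> [Lprime AL Lmin] nAprime.
have [[[Q0 QB QM] [_ _ Qr]] [_ LT _]] := (Qid, Lprime).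
have QL r : r \in R -> Q r -> L r by move=> Rr Qx; rewrite -QRL.
have LQ : L `<=` Q by move=> x; rewrite -QRL => -[].
have QD x y : Q x -> Q y -> Q (x + y) by apply: left_ideal_addr; case: Qid.
split.
- apply: prime_idealW => //.
    by move=> QT; apply: LT; apply/seteqP; split=> // r _;
      apply: QL; [exact: valP|rewrite QT].
  move=> x y xTy; have [r Rr Qxr] := Qsup x; have [u Ru Qyu] := Qsup y.
  have [s|Lr|Lu] := prime_idealM (x := Subring Rr) (y := Subring Ru) Lprime.
  + apply: QL; [exact: valP|rewrite /=].
    have -> : r * subring_val s * u =
        x * subring_val s * y - x * subring_val s * (y - u)
        - (x - r) * subring_val s * u.
      rewrite mulrBr opprB [_ * y + _]addrC subrK.
      by rewrite !mulrBl opprB addrC subrK.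
    by apply: (QB); [apply: (QB); [exact: xTy|exact: QM]|exact/Qr/Qr].
  + by left; rewrite -[x](subrK r); apply: QD => //; exact: LQ.
  + by right; rewrite -[y](subrK u); apply: QD => //; exact: LQ.
- by move=> x Ax; apply: LQ; exact: (AL (Subring (colon_sub Ax))).
- move=> P Pprime AP PQ; apply/seteqP; split=> // x Qx.
  have [Pid PT _] := Pprime; have [Pl [_ _ Pr]] := Pid.
  have [_ PB PM] := Pl.
  have nPA : ~ P `<=` A.
    by move=> PA; apply: nAprime; suff <- : P = A by []; apply/seteqP.
  have Psup := ideal_supplement Pid nPA.
  have PRL : inter_subring R P = inter_subring R L.
    apply: Lmin; last by move=> r Pr1; apply: QL; [exact: valP|exact: PQ].
      apply: prime_idealW.
      + by split; split; rewrite /inter_subring /= ?rmorph0; case: Pl => // *;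
          [exact: PB|exact: PM|exact: PB|exact: Pr].
      + move=> RPT; apply: PT; apply: left_ideal_eqT => //.
        by have : inter_subring R P 1 by rewrite RPT.
      + move=> u v uRv; apply: (prime_idealM Pprime) => t.
        have [r Rr Ptr] := Psup t; rewrite -[t](subrK r) mulrDr mulrDl.
        apply: left_ideal_addr => //; first exact/Pr/PM.
        exact: (uRv (Subring Rr)).
    by move=> r Ar1; apply: AP.
  have [r Rr Pxr] := Psup x; rewrite -[x](subrK r).
  apply: left_ideal_addr => //.
  suff : inter_subring R P (Subring Rr) by [].
  rewrite PRL; apply: QL => //=.
  rewrite -[r]opprK -sub0r; apply: (QB) => //.
  have -> : - r = (x - r) - x by rewrite addrAC subrr sub0r.
  by apply: (QB) => //; exact: PQ.
Qed.

End Lift.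

End MaximalSubringTheory.

(** * The conductors of a maximal subring *)

Section Conductors.
Variables (T : nzRingType) (R : subringClosed T).
Hypothesis maxR : maximal_subring R.

Let A := colon R.
Let Al := colon_l R.
Let Ar := colon_r R.
Let RA := inter_subring R A.
Let RAl := inter_subring R Al.
Let RAr := inter_subring R Ar.

Lemma colon_r_prime : prime_ideal RAr.
Proof.
have Arprime := colon_l_primeM (conv_maximal_subring maxR).
apply: prime_idealW; first exact: colon_r_idealP.
- have [t /negP tR] := maximal_subring_proper maxR.
  move=> RT; apply: tR; have : RAr 1 by rewrite RT.
  by move=> /(_ t); rewrite /= mul1r.
- move=> x y xRy; have [||||] := Arprime (val y) (val x); try exact: valP.
  + move=> r Rr t; have := xRy (@Subring _ R r Rr) t.
    by rewrite /= -(mulrA (subring_val x)).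
  + by right.
  + by left.
Qed.

Lemma colon_comparable_r : Ar `<=` Al <-> A = Ar.
Proof.
split=> [rl|<-]; last exact: colon_sub_l.
apply/seteqP; split; first exact: colon_sub_r.
by move=> x Arx a b; rewrite -mulrA; apply: rl => t; rewrite -mulrA; exact: Arx.
Qed.

Lemma colon_r_lift (I J : set T) : ideal I ->
  (forall x y, I x -> J y -> A (x * y)) ->
  (forall t, exists2 r, r \in R & I (t - r)) ->
  (forall t, exists2 r, r \in R & J (t - r)) ->
  exists Q : set T, [/\ ideal Q, I `<=` Q & Q `&` [set` R] = Ar].
Proof.
move=> [Il Ir] IJA Isup Jsup.
have JIA (x y : T^c) : J x -> I y -> colon (conv_subring R) (x * y).
  by move=> Jx Iy a b; have := IJA _ _ Iy Jx b a; rewrite -mulrA.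
have [Q [[Ql Qr] IQ QR]] := @colon_l_lift T^c (conv_subring R) J I
  (conj Ir Il) JIA Jsup Isup.
by exists Q.
Qed.

Lemma colon_le_l : RA `<=` RAl.
Proof. by move=> x; exact: colon_sub_l. Qed.

Lemma colon_le_r : RA `<=` RAr.
Proof. by move=> x; exact: colon_sub_r. Qed.

Lemma inter_colon_ideal : ideal RA.
Proof.
have [[A0 AB Ami] [_ _ Amr]] := colon_ideal R.
have RA0 : RA 0 by exact: A0.
have RAB x y : RA x -> RA y -> RA (x - y) by exact: AB.
by split; split=> // a x RAx; [exact: Ami|exact: Amr].
Qed.

(** The inclusion of [RAl RAr] in [RA] is the reason why [RA] has at most two
    minimal primes. *)
Lemma prime_over_colon (P : set (subring R)) :
  prime_ideal P -> RA `<=` P -> RAl `<=` P \/ RAr `<=` P.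
Proof.
move=> [[Pl _] _ PP] AP; apply: PP; [exact: colon_l_idealP|exact: colon_r_idealP|].
by apply: ideal_prod_subset => // x y Alx Ary; apply: AP; exact: colon_lrM.
Qed.

Lemma min_primes_colon_sub : min_primes RA `<=` [set RAl; RAr].
Proof.
move=> P [Pprime AP Pmin]; have [lP|rP] := prime_over_colon Pprime AP.
- by left; apply/esym; apply: Pmin => //; [exact: (colon_l_prime maxR)|exact: colon_le_l].
- by right; apply/esym; apply: Pmin => //; [exact: colon_r_prime|exact: colon_le_r].
Qed.

Lemma min_primes_colon_l : (Ar `<=` Al -> Al `<=` Ar) -> min_primes RA RAl.
Proof.
move=> rl_lr; split; [exact: (colon_l_prime maxR)|exact: colon_le_l|].
move=> P Pprime AP Pl; apply/seteqP; split=> //.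
have [//|rP] := prime_over_colon Pprime AP.
have rl : Ar `<=` Al.
  by apply: (inter_subringS (R := R)) => [|x /rP/Pl]; first exact: colon_r_sub.
by move=> x Alx; apply: rP; exact: rl_lr.
Qed.

Lemma min_primes_colon_r : (Al `<=` Ar -> Ar `<=` Al) -> min_primes RA RAr.
Proof.
move=> lr_rl; split; [exact: colon_r_prime|exact: colon_le_r|].
move=> P Pprime AP Pr; apply/seteqP; split=> //.
have [lP|//] := prime_over_colon Pprime AP.
have lr : Al `<=` Ar.
  by apply: (inter_subringS (R := R)) => [|x /lP/Pr]; first exact: colon_l_sub.
by move=> x Arx; apply: lP; exact: lr_rl.
Qed.

Lemma min_primes_comparable : Al `<=` Ar \/ Ar `<=` Al ->
  exists P, min_primes RA = [set P].
Proof.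
have minE P : min_primes RA P -> P `<=` RAl -> P `<=` RAr ->
    min_primes RA = [set P].
  move=> Pmin Pl Pr; have [Pprime AP _] := Pmin.
  apply/seteqP; split=> [Q Qmin|_ -> //]; have [_ _ QM] := Qmin.
  apply/esym; apply: QM => //.
  by have [->|->] := min_primes_colon_sub Qmin.
move=> [lr|rl].
- exists RAl; apply: minE; first exact: min_primes_colon_l.
    by [].
  by move=> x; exact: lr.
- exists RAr; apply: minE; first exact: min_primes_colon_r.
    by move=> x; exact: rl.
  by [].
Qed.

Lemma prime_colonE : prime_ideal RA <-> A = Al \/ A = Ar.
Proof.
split=> [Aprime|[Al_A|Ar_A]]; last 2 first.
- by rewrite /RA Al_A; exact: (colon_l_prime maxR).
- by rewrite /RA Ar_A; exact: colon_r_prime.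
have [lA|rA] := prime_over_colon Aprime (fun x => id).
- left; apply/seteqP; split; first exact: colon_sub_l.
  exact: (inter_subringS (@colon_l_sub T R) lA).
- right; apply/seteqP; split; first exact: colon_sub_r.
  exact: (inter_subringS (@colon_r_sub T R) rA).
Qed.

Lemma nilpotent_sub_colon (I : set (subring R)) : ideal I ->
  nilpotent_ideal I -> I `<=` RAl `&` RAr /\ ideal_pow I 2 `<=` RA.
Proof.
move=> Iid Inil.
have Ilr : I `<=` RAl `&` RAr.
  move=> x Ix; split.
    exact: (nilpotent_ideal_sub_prime (colon_l_prime maxR) Iid Inil).
  exact: (nilpotent_ideal_sub_prime colon_r_prime Iid Inil).
split=> //; apply: ideal_prod_subset; first by case: inter_colon_ideal.
by move=> x y /Ilr[Alx _] /Ilr[_ Ary]; exact: colon_lrM.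
Qed.

(** If [A] is not prime in [T], ideals [I] and [J] of [T] outside [A] with product
    in [A] supplement [R], and [J + Al] and [I + Ar] are the primes sought. *)
Lemma incomparable_lift : ~ (Al `<=` Ar \/ Ar `<=` Al) -> ~ prime_ideal A ->
  exists Ql Qr : two_sided_ideal T,
    [/\ min_primes A Ql /\ min_primes A Qr,
        Ql `&` [set` R] = Al,
        Qr `&` [set` R] = Ar,
        ring_isomorphic (quot_ring (colon_l_ideal R)) (quot_ring Ql) &
        ring_isomorphic (quot_ring (colon_r_ideal R)) (quot_ring Qr)].
Proof.
move=> ncomp nAprime.
have [I [J [Iid Jid IJA nIA nJA]]] : exists I J : set T, [/\ ideal I, ideal J,
    ideal_prod I J `<=` A, ~ I `<=` A & ~ J `<=` A].
  apply: contrapT => noIJ; apply: nAprime.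
  split; [exact: colon_ideal|exact: (colon_proper maxR)|].
  move=> I J Iid Jid IJA; have [|nIA] := pselect (I `<=` A); first by left.
  have [|nJA] := pselect (J `<=` A); first by right.
  by case: noIJ; exists I, J.
have IJM x y : I x -> J y -> A (x * y).
  by move=> Ix Jy; apply/IJA/ideal_prodM.
have Isup := ideal_supplement maxR Iid nIA; have Jsup := ideal_supplement maxR Jid nJA.
have [Ql [Qlid JQl QlR]] := colon_l_lift Jid IJM Isup Jsup.
have [Qr [Qrid IQr QrR]] := colon_r_lift Iid IJM Isup Jsup.
have Qlsup t : exists2 r, r \in R & Ql (t - r).
  by have [r Rr Jtr] := Jsup t; exists r => //; exact: JQl.
have Qrsup t : exists2 r, r \in R & Qr (t - r).
  by have [r Rr Itr] := Isup t; exists r => //; exact: IQr.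
exists (TwoSidedIdeal Qlid), (TwoSidedIdeal Qrid); split=> //.
- split.
  + apply: (lift_min_primes maxR Qlid QlR) => //; apply: min_primes_colon_l.
    by move=> rl; case: ncomp; right.
  + apply: (lift_min_primes maxR Qrid QrR) => //; apply: min_primes_colon_r.
    by move=> lr; case: ncomp; left.
- exact: (lift_quot_isomorphic Qlid QlR).
- exact: (lift_quot_isomorphic Qrid QrR).
Qed.

End Conductors.

Lemma card_le_set2 (U : Type) (a b : U) : [set a; b] #<= `I_2.
Proof.
pose f n := if n == 0%N then a else b.
apply: (card_le_trans _ (card_image_le f `I_2)); apply: subset_card_le.
by move=> _ [->|->]; [exists 0%N|exists 1%N].
Qed.

Lemma card_eq1_inj (U : Type) (X : set U) (a b : U) :
  X #= `I_1 -> X a -> X b -> a = b.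
Proof.
move=> /eq_cardSP[x Xx]; rewrite II0 card_eq0 => /eqP Xx0 Xa Xb.
have eqx c : X c -> c = x.
  move=> Xc; apply: contrapT => cx.
  by have : (X `\ x) c by []; rewrite Xx0.
by rewrite (eqx a) // (eqx b).
Qed.

Lemma maximal_ideal_eq (S : pzRingType) (I J : set S) :
  maximal_ideal I -> ideal J -> J <> setT -> I `<=` J -> J = I.
Proof. by move=> [_ _ Imax] Jid JT /(Imax _ Jid)[]. Qed.

Theorem proposition2p2 (T : nzRingType) (R : subringClosed T) :
  maximal_subring R ->
  let A := colon R in
  let Al := colon_l R in
  let Ar := colon_r R in
  let RA := inter_subring R A in
  let RAl := inter_subring R Al in
  let RAr := inter_subring R Ar in
  let lr_comparable := Al `<=` Ar \/ Ar `<=` Al in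
  let J := jacobson (subring R) in
  let N := upper_nilradical (subring R) in
  (* (1) *)
  (prime_radical RA = RAl `&` RAr) /\
  (* (2) *)
  ((prime_ideal RA <-> (A = Al \/ A = Ar)) /\
   (prime_ideal RA <-> lr_comparable)) /\
  (* (3) *)
  [/\ min_primes RA #<= `I_2,
      min_primes RA #= `I_1 <-> lr_comparable &
      ~ lr_comparable ->
        min_primes RA = [set RAl; RAr] /\
        (prime_ideal A \/
         exists Ql Qr : two_sided_ideal T,
           [/\ min_primes A Ql /\ min_primes A Qr,
               Ql `&` [set` R] = Al,
               Qr `&` [set` R] = Ar,
               ring_isomorphic (quot_ring (colon_l_ideal R))
                 (quot_ring Ql) &
               ring_isomorphic (quot_ring (colon_r_ideal R))
                 (quot_ring Qr)])] /\
  (* (4) *)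
  (semiprime_ideal RA <-> A = Al `&` Ar) /\
  (* (5) *)
  (zero_dimensional (subring R) ->
     [/\ maximal_ideal RAl, maximal_ideal RAr &
         (A = Al /\ Al = Ar) \/ ideal_sum RAl RAr = setT]) /\
  (* (6) *)
  ([/\ A = quot_rann setT Ar,
       A = quot_lann setT Al,
       A = quot_lann [set` R] Al &
       A = quot_rann [set` R] Ar] /\
   (maximal_left_ideal Al -> left_primitive_ideal A) /\
   (maximal_right_ideal Ar -> right_primitive_ideal A)) /\
  (* (7) *)
  (maximal_ideal RA -> A = Al /\ Al = Ar) /\
  (* (8) *)
  ((left_artinian (subring R) \/ right_artinian (subring R) ->
      nilpotent_ideal J) /\
   (nilpotent_ideal J -> J `<=` RAl `&` RAr /\ ideal_pow J 2 `<=` RA)) /\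
  (* (9) *)
  ((left_noetherian (subring R) \/ right_noetherian (subring R) ->
      nilpotent_ideal N) /\
   (nilpotent_ideal N -> N `<=` RAl `&` RAr /\ ideal_pow N 2 `<=` RA)).
Proof.
move=> maxR A Al Ar RA RAl RAr lr_comparable J N.
have lprime : prime_ideal RAl := colon_l_prime maxR.
have rprime : prime_ideal RAr := colon_r_prime maxR.
have [lid lT _] := lprime; have [rid rT _] := rprime.
have primeE : prime_ideal RA <-> lr_comparable.
  rewrite (prime_colonE maxR) /lr_comparable.
  by rewrite colon_comparable_l colon_comparable_r.
have eq_lr : Al = Ar -> A = Al.
  by move=> lr; apply/colon_comparable_l; rewrite -/Al lr.
split; [|split; [|split; [|split; [|split; [|split; [|split; [|split]]]]]]].
- apply/seteqP; split=> [x radx|x [lx rx] P [Pprime AP]].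
    by split; apply: radx; split=> //; [exact: colon_le_l|exact: colon_le_r].
  by have [lP|rP] := prime_over_colon Pprime AP; [exact: lP|exact: rP].
- by split=> //; exact: prime_colonE.
- split.
  + apply: card_le_trans (card_le_set2 RAl RAr).
    by apply: subset_card_le; exact: min_primes_colon_sub.
  + split=> [card1|/(min_primes_comparable maxR)[P ->]]; last exact: card_set1.
    apply: contrapT => ncomp; apply: (ncomp); left => x Alx.
    have lr : RAl = RAr.
      apply: (card_eq1_inj card1).
        by apply: min_primes_colon_l => // rl; case: ncomp; right.
      by apply: min_primes_colon_r => // lr; case: ncomp; left.
    suff <- : Al = Ar by [].
    by apply: inter_subring_inj lr; [exact: colon_l_sub|exact: colon_r_sub].
  + move=> ncomp; split.
      apply/seteqP; split; first exact: min_primes_colon_sub.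
      move=> _ [->|->].
        by apply: min_primes_colon_l => // rl; case: ncomp; right.
      by apply: min_primes_colon_r => // lr; case: ncomp; left.
    have [|nAprime] := pselect (prime_ideal A); first by left.
    by right; exact: incomparable_lift.
- split=> [[_ Asemi]|AE].
    apply/seteqP; split.
      by move=> x Ax; split; [exact: colon_sub_l|exact: colon_sub_r].
    apply: (@inter_subringS _ R); first by move=> x [/colon_l_sub].
    (* the square of the intersection of Al and Ar lies in Al Ar, hence in A *)
    apply: (Asemi (RAl `&` RAr)); first exact: idealI.
    apply: ideal_prod_subset; first by case: (inter_colon_ideal R).
    by move=> x y [lx _] [_ ry]; exact: colon_lrM.
  split; first exact: inter_colon_ideal.
  move=> I Iid IA.
  have Il : I `<=` RAl.
    by apply: (prime_ideal_pow lprime Iid (n := 2)) => x /IA/colon_le_l.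
  have Ir : I `<=` RAr.
    by apply: (prime_ideal_pow rprime Iid (n := 2)) => x /IA/colon_le_r.
  by move=> x Ix; rewrite /RA /inter_subring /= AE; split; [exact: Il|exact: Ir].
- move=> zd; have lmax := zd _ lprime; have rmax := zd _ rprime.
  split=> //; have [_ _ lext] := lmax.
  have sumid : ideal (ideal_sum RAl RAr) by exact: ideal_sum_ideal.
  have [|suml|] := lext _ sumid; [|left|by right].
    by move=> x lx; exists x => //; exists 0; [case: rid => -[]|rewrite addr0].
  have lr : Al = Ar.
    apply: (@inter_subring_inj _ R); [exact: colon_l_sub|exact: colon_r_sub|].
    apply: (maximal_ideal_eq rmax) => // x rx; rewrite -/RAl -suml.
    by exists 0; [case: lid => -[]|exists x => //; rewrite add0r].
  by split=> //; exact: eq_lr.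
- split.
    split; apply/seteqP; split.
    + by move=> x Ax; split=> // t s; exact: Ax.
    + by move=> x [_ Arx] a b; exact: Arx.
    + by move=> x Ax; split=> // t s; rewrite mulrA; exact: Ax.
    + by move=> x [_ Alx] a b; rewrite -mulrA; exact: Alx.
    + by move=> x Ax; split; [exact: colon_sub|move=> t s; rewrite mulrA; exact: Ax].
    + by move=> x [_ Alx] a b; rewrite -mulrA; exact: Alx.
    + by move=> x Ax; split; [exact: colon_sub|move=> t s; exact: Ax].
    + by move=> x [_ Arx] a b; exact: Arx.
  split=> [lmax|rmax].
    suff -> : A = [set x | forall t, Al (x * t)].
      exact: maximal_left_ideal_primitive.
    apply/seteqP; split=> [x Ax t s|x Alx a b].
      by rewrite mulrA; exact: Ax.
    by rewrite -mulrA; exact: Alx.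
  suff -> : A = [set x | forall t, Ar (t * x)].
    exact: (@maximal_left_ideal_primitive T^c Ar).
  by apply/seteqP; split=> [x Ax t s|x Arx a b]; [exact: Ax|exact: Arx].
- move=> Amax.
  have lA : RAl = RA by apply: maximal_ideal_eq => //; exact: colon_le_l.
  have rA : RAr = RA by apply: maximal_ideal_eq => //; exact: colon_le_r.
  have lr : Al = Ar.
    apply: (@inter_subring_inj _ R); [exact: colon_l_sub|exact: colon_r_sub|].
    by rewrite -/RAl lA.
  by split=> //; exact: eq_lr.
- split; first exact: artinian_jacobson_nilpotent.
  exact/nilpotent_sub_colon/jacobson_ideal.
- split; first exact: noetherian_upper_nilradical_nilpotent.
  apply: nilpotent_sub_colon => //.
  by have [[]] := @upper_nilradicalP (subring R).
Qed.
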